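(* Let $X$ be a set and let $\varnothing\neq Z\subsetneq Y\subsetneq X$. Then the following statements hold: (i) if $|Z|=1$, the semigroup $\mathcal{T}(X,Y,Z)$ is right abundant; (ii) if $|Z|\geq 2$, the semigroup $\mathcal{T}(X,Y,Z)$ is neither left abundant nor right abundant.
   Context: $\mathcal{T}(X)$ is the full transformation semigroup on $X$ (all maps $X\to X$ under composition). Maps are written on the right, so $x(\alpha\beta)=(x\alpha)\beta$, and $A\alpha=\{a\alpha : a\in A\}$ for $A\subseteq X$. For $\varnothing\neq Z\subseteq Y\subseteq X$, $\mathcal{T}(X,Y,Z)=\{\alpha\in\mathcal{T}(X): Y\alpha\subseteq Z\}$, a subsemigroup of $\mathcal{T}(X)$. For a semigroup $S$, $S^1$ is $S$ with an identity adjoined if $S$ has none, and $S^1=S$ otherwise. Elements $a,b\in S$ are $\mathcal{L}$-related in $S$ if $S^1a=S^1b$, and $\mathcal{R}$-related in $S$ if $aS^1=bS^1$. Elements $a,b\in S$ are $\mathcal{L}^{\ast}$-related (resp. $\mathcal{R}^{\ast}$-related) in $S$ if they are $\mathcal{L}$-related (resp. $\mathcal{R}$-related) in some oversemigroup of $S$, i.e. some semigroup containing $S$ as a subsemigroup. $\mathcal{L}^{\ast}$ and $\mathcal{R}^{\ast}$ are equivalence relations on $S$. $S$ is left abundant (resp. right abundant) if every $\mathcal{L}^{\ast}$-class (resp. every $\mathcal{R}^{\ast}$-class) of $S$ contains an idempotent, i.e. an element $e$ with $e^2=e$. *)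

(* Defs.v *)
From HB Require Import structures.
From mathcomp Require Import all_boot.
From mathcomp Require Import boolp classical_sets functions cardinality.

Set Implicit Arguments.
Unset Strict Implicit.
Unset Printing Implicit Defensive.

Local Open Scope classical_set_scope.
Local Open Scope group_scope.

Section Green.
Variable S : semigroupType.
Implicit Types (a b : S) (x y : option S).

Definition has_identity : Prop := exists e : S, left_id e *%g /\ right_id e *%g.

(* The monoid S^1, realised inside [option S]: [Some] embeds S and [None] is
   the adjoined identity, which is present only when S has none of its own. *)
Definition adj1 : set (option S) :=
  [set x | x = None -> ~ has_identity].

Definition mul1 x y : option S :=
  match x, y with
  | Some s, Some t => Some (s * t)
  | None, _ => y
  | _, None => x
  end.

(* S^1 a = S^1 b *)
Definition Lrel a b : Prop :=
  [set mul1 x (Some a) | x in adj1] = [set mul1 x (Some b) | x in adj1].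

(* a S^1 = b S^1 *)
Definition Rrel a b : Prop :=
  [set mul1 (Some a) x | x in adj1] = [set mul1 (Some b) x | x in adj1].

End Green.

Section Abundance.
Variable S : semigroupType.
Implicit Types a b e : S.

(* An oversemigroup of S is presented as an injective multiplicative map out
   of S. *)
Definition Lstar a b : Prop :=
  exists (T : semigroupType) (i : {multiplicative S -> T}),
    injective i /\ Lrel (i a) (i b).

Definition Rstar a b : Prop :=
  exists (T : semigroupType) (i : {multiplicative S -> T}),
    injective i /\ Rrel (i a) (i b).

Definition idempotent_elt e : Prop := e * e = e.

Definition left_abundant : Prop :=
  forall a, exists2 e, Lstar a e & idempotent_elt e.

Definition right_abundant : Prop :=
  forall a, exists2 e, Rstar a e & idempotent_elt e.

End Abundance.

Arguments left_abundant S : clear implicits.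
Arguments right_abundant S : clear implicits.

Definition transf (X : Type) : Type := X -> X.

HB.instance Definition _ (X : Type) := gen_eqMixin (transf X).
HB.instance Definition _ (X : Type) := gen_choiceMixin (transf X).

(* Maps act on the right: x (f * g) = (x f) g. *)
Definition transf_mul (X : Type) (f g : transf X) : transf X :=
  fun x => g (f x).

Lemma transf_mulA (X : Type) : associative (@transf_mul X).
Proof. by []. Qed.

HB.instance Definition _ (X : Type) :=
  isSemigroup.Build (transf X) (@transf_mulA X).

Section TransfYZ.
Variables (X : Type) (Y Z : set X).

Definition maps_into : pred (transf X) := fun f => `[< f @` Y `<=` Z >].

Lemma maps_into_mulg_closed : Z `<=` Y -> mulg_closed maps_into.
Proof.
move=> ZY f g /asboolP fYZ /asboolP gYZ; apply/asboolP => _ [y Yy <-].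
by apply: gYZ; exists (f y) => //; apply/ZY/fYZ; exists y.
Qed.

(* T(X,Y,Z); the type carries the proof of Z `<=` Y, without which the product
   of T(X) need not restrict to it. *)
Record transfYZ (ZY : Z `<=` Y) : Type :=
  TransfYZ { transfYZ_val :> transf X; _ : maps_into transfYZ_val }.

Variable ZY : Z `<=` Y.

HB.instance Definition _ := [isSub of transfYZ ZY for @transfYZ_val ZY].
HB.instance Definition _ := [Choice of transfYZ ZY by <:].
HB.instance Definition _ :=
  SubChoice_isSubSemigroup.Build (transf X) maps_into (transfYZ ZY)
    (maps_into_mulg_closed ZY).

End TransfYZ.

(* Main.v *)
(** If [e] is idempotent and [a] is R*-related to [e] then [e * a = a], because
    [a] is a right multiple of [e] in some oversemigroup; dually, L*-relatedness
    gives [a * e = a].  An idempotent of T(X,Y,Z) maps [Y] into [Z], so the first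
    identity forces [Y a = Z a], and the second forces every point of [Y] in the
    image of [a], being fixed by [e], to lie in [Z].  Both conclusions are easily
    violated.  When [Z = {z}], choosing a representative in each kernel class of
    [a], with [z] for the class containing [Y], gives an idempotent that is
    R-related to [a] in T(X). *)
Require Import Defs.
From HB Require Import structures.
From mathcomp Require Import all_boot.
From mathcomp Require Import boolp classical_sets functions cardinality.

Local Open Scope classical_set_scope.
Local Open Scope card_scope.

Section StarRelations.
Local Set Implicit Arguments.
Local Open Scope group_scope.

Lemma Lrel_mem (S : semigroupType) (a b : S) :
  Lrel a b -> exists2 x, adj1 x & mul1 x (Some b) = Some a.
Proof.
rewrite /Lrel => ab.
suff : [set mul1 x (Some a) | x in @adj1 S] (Some a) by rewrite ab.
(* If [S] has its own identity, [None] is excluded from [adj1], so that identity must be the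
   witness. *)
have [[e [el er]]|noid] := pselect (has_identity S); last by exists None.
by exists (Some e) => //=; rewrite el.
Qed.

Lemma Rrel_mem (S : semigroupType) (a b : S) :
  Rrel a b -> exists2 x, adj1 x & mul1 (Some b) x = Some a.
Proof.
rewrite /Rrel => ab.
suff : [set mul1 (Some a) x | x in @adj1 S] (Some a) by rewrite ab.
have [[e [el er]]|noid] := pselect (has_identity S); last by exists None.
by exists (Some e) => //=; rewrite er.
Qed.

Lemma Rrel_mutual_multiples (S : semigroupType) (a b c d : S) :
  a = b * c -> b = a * d -> Rrel a b.
Proof.
suff sub (u v w : S) : u = v * w ->
    [set mul1 (Some u) x | x in @adj1 S] `<=` [set mul1 (Some v) x | x in @adj1 S].
  by move=> abc bad; apply/seteqP; split; [exact: sub abc|exact: sub bad].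
move=> uvw _ [[s|] _ <-] /=; last by exists (Some w) => //=; rewrite -uvw.
by exists (Some (w * s)) => //=; rewrite mulgA -uvw.
Qed.

Lemma Lstar_idempotent_mulr (S : semigroupType) (a e : S) :
  Lstar a e -> idempotent_elt e -> a * e = a.
Proof.
move=> [T [i [i_inj /Lrel_mem[x _ ax]]]] ee; apply: i_inj; rewrite gmulfM.
by case: x ax => [t|] /= [<-]; rewrite -?mulgA -gmulfM ee.
Qed.

Lemma Rstar_idempotent_mull (S : semigroupType) (a e : S) :
  Rstar a e -> idempotent_elt e -> e * a = a.
Proof.
move=> [T [i [i_inj /Rrel_mem[x _ ax]]]] ee; apply: i_inj; rewrite gmulfM.
by case: x ax => [t|] /= [<-]; rewrite ?mulgA -gmulfM ee.
Qed.

End StarRelations.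

Section TransformationsYZ.
Local Set Implicit Arguments.
Variables (X : Type) (Y Z : set X) (ZY : Z `<=` Y).
Local Notation S := (transfYZ ZY).

Lemma transfYZ_into (f : S) (y : X) : Y y -> Z (val f y).
Proof. by case: f => f /= /asboolP fYZ Yy; apply: fYZ; exists y. Qed.

Lemma transfYZ_ext (f : X -> X) :
  (forall y, Y y -> Z (f y)) -> exists g : S, forall x, val g x = f x.
Proof.
move=> fYZ; have fP : maps_into Y Z f by apply/asboolP => _ [y /fYZ ? <-].
by exists (TransfYZ ZY fP).
Qed.

Lemma transfYZ_inj (f g : S) : (val f : X -> X) =1 val g -> f = g.
Proof. by move=> fg; apply: val_inj; apply/funext. Qed.

Lemma transfYZ_mulE (f g : S) (x : X) : val (f * g)%g x = val g (val f x).
Proof. by []. Qed.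

Lemma transfYZ_singleton_right_abundant (z : X) :
  Z = [set z] -> right_abundant S.
Proof.
move=> Zz a; have inZ u : Z u <-> u = z by rewrite Zz.
have Yz : Y z by apply/ZY/inZ.
have aY y : Y y -> val a y = z by move=> /(transfYZ_into a)/inZ.
(* [r] is a section of [a] on its image, normalised by [r z = z]; this is consistent because [z]
   lies in [Y] and so [a] fixes it. Off the image and away from [z], the value is arbitrary. *)
have /choice[r rP] : forall w, exists v,
    (w = z -> v = z) /\ ((exists x, val a x = w) -> val a v = w).
  move=> w; have [->|wz] := pselect (w = z).
    by exists z; split=> // _; exact: aY.
  by have [[x xw]|nx] := pselect (exists x, val a x = w); [exists x|exists w].
have ar x : val a (r (val a x)) = val a x by apply: (rP _).2; exists x.
have [|e eE] := @transfYZ_ext (fun x => r (val a x)).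
  by move=> y /aY ->; apply/inZ/(rP z).1.
exists e; last by apply: transfYZ_inj => x; rewrite transfYZ_mulE !eE ar.
(* The oversemigroup is needed because [r] may send points of [Y] outside [Z]. In [transf X],
   [a = e * a] and [e = a * r]. *)
exists (transf X), (val : {multiplicative S -> transf X}).
split; first exact: val_inj.
apply: (@Rrel_mutual_multiples _ _ _ (val a) r); apply/funext => x.
  by rewrite -[LHS]ar -eE.
exact: eE.
Qed.

Lemma transfYZ_not_left_abundant :
  Z !=set0 -> Y `\` Z !=set0 -> ~` Y !=set0 -> ~ left_abundant S.
Proof.
move=> [z Zz] [y [Yy nZy]] [x nYx] la.
(* Membership in [S] only constrains [a] on [Y], so a point outside [Y] can be sent to [y], which
   lies in [Y] but not in [Z]. *)
have [|a aE] := @transfYZ_ext (fun u => if `[< Y u >] then z else y).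
  by move=> u Yu; rewrite asboolT.
have [e ae ee] := la a.
have ax : val a x = y by rewrite aE asboolF.
have /(congr1 (fun f : S => val f x)) := Lstar_idempotent_mulr ae ee.
by rewrite transfYZ_mulE ax => ey; apply: nZy; rewrite -ey; exact: transfYZ_into.
Qed.

Lemma transfYZ_not_right_abundant (z1 z2 : X) :
  Z z1 -> Z z2 -> z1 <> z2 -> Y `\` Z !=set0 -> ~ right_abundant S.
Proof.
move=> Zz1 Zz2 z12 [y [Yy nZy]] ra.
(* This [a] separates [Z] from its complement: [e] moves [y] into [Z], so [e * a] sends [y] to [z1],
   whereas [a] sends it to [z2]. *)
have [|a aE] := @transfYZ_ext (fun u => if `[< Z u >] then z1 else z2).
  by move=> u _; case: ifP.
have [e ae ee] := ra a.
have /(congr1 (fun f : S => val f y)) := Rstar_idempotent_mull ae ee.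
by rewrite transfYZ_mulE !aE asboolT ?asboolF//; exact: transfYZ_into.
Qed.

End TransformationsYZ.

Lemma card_eq1_singleton (T : Type) (A : set T) :
  A !=set0 -> A #= `I_1 -> exists x, A = [set x].
Proof.
move=> [x Ax] /card_eqPle[/pcard_leP[f] _]; exists x.
have f0 y : A y -> f y = 0%N.
  by move=> Ay; have /(_ y Ay) : set_fun A `I_1 f by []; case: (f y).
apply/seteqP; split=> [y Ay|_ ->//].
apply: (@inj _ _ _ f); rewrite ?inE//.
exact: etrans (f0 _ Ay) (esym (f0 _ Ax)).
Qed.

Lemma card_ge2_distinct (T : Type) (A : set T) :
  A !=set0 -> `I_2 #<= A -> exists x y, [/\ A x, A y & x <> y].
Proof.
move=> [x Ax] A2; have [[y [Ay xy]]|A1] := pselect (exists y, A y /\ x <> y).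
  by exists x, y.
have Ax1 : A = [set x].
  apply/seteqP; split=> [y Ay|_ ->//].
  by apply: contrapT => yx; apply: A1; exists y; split=> // /esym.
(* For a singleton the cardinality bound would read [2 <= 1]. *)
by move: A2; rewrite Ax1 (card_le_eqr card_set1) card_le_II.
Qed.

Theorem theorem3p8 (X : Type) (Y Z : set X) (Z0 : Z !=set0)
    (ZY : Z `<` Y) (YX : Y `<` [set: X]) :
  (Z #= `I_1 -> right_abundant (transfYZ (properW ZY))) /\
  (`I_2 #<= Z ->
     ~ left_abundant (transfYZ (properW ZY)) /\
     ~ right_abundant (transfYZ (properW ZY))).
Proof.
have YZ0 : Y `\` Z !=set0 by apply/nonsubset/ZY.2.
have YC0 : ~` Y !=set0 by rewrite -setTD; apply/nonsubset/YX.2.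
split=> [Z1|/(card_ge2_distinct _ _ Z0)[z1 [z2 [Zz1 Zz2 z12]]]].
  have [z Zz] := card_eq1_singleton _ _ Z0 Z1.
  exact: transfYZ_singleton_right_abundant Zz.
split; first exact: transfYZ_not_left_abundant.
exact: transfYZ_not_right_abundant Zz1 Zz2 z12 YZ0.
Qed.
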